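(* Let $(A,\cdot,\Phi=\{\partial_k\}_{k=1}^m)$ be a differential algebra and let $r\in A\otimes A$ be antisymmetric. Let $\Psi=\{\eth_k\colon A\to A\}_{k=1}^m$ be a set of commuting linear maps. Then $r$ is a solution of the $\Psi$-admissible associative Yang--Baxter equation in $(A,\cdot,\Phi)$ if and only if $r^\sharp\colon A^*\to A$ satisfies the following equations: $$r^\sharp(a^* )\cdot r^\sharp(b^* )=r^\sharp\big(R_A^*(r^\sharp(a^* ))b^*+L_A^*(r^\sharp(b^* ))a^*\big)\quad\text{for all }a^*,b^*\in A^*,$$ $$\partial_kr^\sharp=r^\sharp\eth_k^*\quad\text{for all }k=1,\dots,m.$$
   Context: All vector spaces and algebras are finite-dimensional over a field $\mathbb F$ of characteristic $0$; ''algebra'' means associative algebra, not necessarily unital. $r$ is antisymmetric if $r=-\sigma(r)$ with $\sigma(a\otimes b)=b\otimes a$. For $r=\sum_ia_i\otimes b_i$, $r^\sharp\colon A^*\to A$ is $r^\sharp(a^* )=\sum_i\langle a^*,a_i\rangle b_i$. $L_A(a)b=a\cdot b=R_A(b)a$; $L_A^*(a)=L_A(a)^*$ and $R_A^*(a)=R_A(a)^*$ are transposes (no sign), and $\eth_k^*$ is the transpose of $\eth_k$. Differential algebra $(A,\cdot,\Phi=\{\partial_k\}_{k=1}^m)$: $(A,\cdot)$ is an algebra and the $\partial_k$ are pairwise commuting derivations. $r=\sum_ia_i\otimes b_i$ is a solution of the $\Psi$-admissible associative Yang--Baxter equation in $(A,\cdot,\Phi)$ if $r_{12}r_{13}+r_{13}r_{23}-r_{23}r_{12}=0$,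 where $r_{12}r_{13}=\sum_{i,j}a_i\cdot a_j\otimes b_i\otimes b_j$, $r_{13}r_{23}=\sum_{i,j}a_i\otimes a_j\otimes b_i\cdot b_j$, $r_{23}r_{12}=\sum_{i,j}a_j\otimes a_i\cdot b_j\otimes b_i$, and for all $k$: $(\partial_k\otimes\mathrm{id}-\mathrm{id}\otimes\eth_k)(r)=0$, $(\eth_k\otimes\mathrm{id}-\mathrm{id}\otimes\partial_k)(r)=0$. *)

(* Defs.v *)
From HB Require Import structures.
From mathcomp Require Import all_boot all_order all_algebra.

Set Implicit Arguments.
Unset Strict Implicit.
Unset Printing Implicit Defensive.

Import GRing.Theory.
Local Open Scope ring_scope.

(* The library has no tensor product of vector spaces.  U ⊗ V is modelled by
   the coordinate matrices in the bases vbasis {:U} and vbasis {:V}; that this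
   is the tensor product, whatever the bases, is the universal property below:
   tensor_bilinear, tlift_tensor and tlift_unique. *)
Section Tensor.
Variables (F : fieldType) (U V : vectType F).

Definition tensor : vectType F := 'M[F]_(\dim {:U}, \dim {:V}).

Definition pure_tensor (u : U) (v : V) : tensor :=
  \matrix_(i, j) (coord (vbasis {:U}) i u * coord (vbasis {:V}) j v).

(* The linear map out of U ⊗ V induced by a bilinear map f. *)
Definition tlift (W : vectType F) (f : U -> V -> W) (t : tensor) : W :=
  \sum_i \sum_j (t : 'M_(_, _)) i j *: f (vbasis {:U})`_i (vbasis {:V})`_j.

End Tensor.

Notation "u ⊗ v" := (pure_tensor u v) (at level 40, left associativity) : ring_scope.

Section TensorTheory.
Variables (F : fieldType) (U V W : vectType F).
Implicit Types (f : U -> V -> W) (t : tensor U V).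

Local Notation bilin f := (bilinear_for *:%R *:%R f).

Lemma tensor_bilinear : bilin (@pure_tensor F U V).
Proof.
split=> [v | u] a x y; apply/matrixP => i j; rewrite !mxE linearP /=.
  by rewrite mulrDl mulrA.
by rewrite mulrDr mulrCA.
Qed.

Lemma tlift_is_linear f : linear (tlift f).
Proof.
move=> a s t; rewrite /tlift scaler_sumr -big_split; apply: eq_bigr => i _ /=.
rewrite scaler_sumr -big_split; apply: eq_bigr => j _ /=.
by rewrite !mxE scalerDl scalerA.
Qed.
HB.instance Definition _ f :=
  GRing.isLinear.Build F (tensor U V) W *:%R (tlift f) (tlift_is_linear f).

Lemma tlift_tensor f : bilin f -> forall u v, tlift f (u ⊗ v) = f u v.
Proof.
move=> [fl fr] u v.
pose fr' u := GRing.isLinear.Build F V W *:%R (f u) (fr u).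
pose fru u : {linear V -> W} := HB.pack (f u) (fr' u).
pose fl' v := GRing.isLinear.Build F U W *:%R (f^~ v) (fl v).
pose flv v : {linear U -> W} := HB.pack (f^~ v) (fl' v).
rewrite {2}(coord_vbasis (memvf u)) -[RHS]/(flv v _) linear_sum.
apply: eq_bigr => i _; rewrite linearZ /= {2}(coord_vbasis (memvf v)).
rewrite -[f _ _]/(fru _ _) linear_sum scaler_sumr; apply: eq_bigr => j _.
by rewrite linearZ /= scalerA mxE.
Qed.

Lemma tensor_decomp t :
  t = \sum_i \sum_j (t : 'M_(_, _)) i j *: ((vbasis {:U})`_i ⊗ (vbasis {:V})`_j).
Proof.
have fU := basis_free (vbasisP {:U}); have fV := basis_free (vbasisP {:V}).
apply/matrixP => k l; rewrite !(summxE, mxE) (bigD1 k) //= [X in _ + X]big1.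
  rewrite addr0 summxE (bigD1 l) //= big1 => [|j jl].
    by rewrite addr0 !mxE !coord_free // !eqxx !mulr1.
  by rewrite !mxE !coord_free // (negPf jl) !mulr0.
move=> i ik; rewrite summxE big1 // => j _.
by rewrite !mxE !coord_free // (negPf ik) mul0r mulr0.
Qed.

Lemma tlift_unique f (g : {linear tensor U V -> W}) :
  (forall u v, g (u ⊗ v) = f u v) -> g =1 tlift f.
Proof.
move=> gf t; rewrite {1}(tensor_decomp t) linear_sum; apply: eq_bigr => i _ /=.
by rewrite linear_sum; apply: eq_bigr => j _; rewrite linearZ /= gf.
Qed.

End TensorTheory.

Section TensorMaps.
Variable F : fieldType.

Definition tswap (U V : vectType F) : tensor U V -> tensor V U :=
  tlift (fun u v => v ⊗ u).

Definition tmap (U V U' V' : vectType F) (f : 'Hom(U, U')) (g : 'Hom(V, V')) :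
    tensor U V -> tensor U' V' :=
  tlift (fun u v => f u ⊗ g v).

Lemma tswap_tensor (U V : vectType F) (u : U) (v : V) :
  tswap (u ⊗ v) = v ⊗ u.
Proof.
have [l r] := @tensor_bilinear F V U.
by rewrite /tswap tlift_tensor //; split=> w c x y; rewrite ?(r w) ?(l w).
Qed.

Lemma tmap_tensor (U V U' V' : vectType F) (f : 'Hom(U, U')) (g : 'Hom(V, V'))
  (u : U) (v : V) : tmap f g (u ⊗ v) = f u ⊗ g v.
Proof.
have [l r] := @tensor_bilinear F U' V'.
rewrite /tmap tlift_tensor //; split=> w c x y; rewrite linearP.
  exact: (l (g w)).
exact: (r (f w)).
Qed.

Definition antisymmetric_tensor (A : vectType F) (r : tensor A A) :=
  r = - tswap r.

End TensorMaps.

Section Dual.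
Variable F : fieldType.

Definition dual (U : vectType F) : vectType F := 'Hom(U, F^o).

Definition transpose_fun (U V : vectType F) (f : 'Hom(U, V)) (p : dual V) :
  dual U := (p \o f)%VF.

Lemma transpose_fun_is_linear (U V : vectType F) (f : 'Hom(U, V)) :
  linear (transpose_fun f).
Proof. by move=> a p q; rewrite /transpose_fun comp_lfunDl comp_lfunZl. Qed.
HB.instance Definition _ (U V : vectType F) (f : 'Hom(U, V)) :=
  GRing.isLinear.Build F (dual V) (dual U) *:%R (transpose_fun f)
    (transpose_fun_is_linear f).

Definition transpose (U V : vectType F) (f : 'Hom(U, V)) :
  'Hom(dual V, dual U) := linfun (transpose_fun f).

Lemma transposeE (U V : vectType F) (f : 'Hom(U, V)) (p : dual V) (u : U) :
  transpose f p u = p (f u).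
Proof. by rewrite lfunE /= comp_lfunE. Qed.

Definition sharp_fun (A : vectType F) (r : tensor A A) (p : dual A) : A :=
  tlift (fun a b => (p a : F) *: b) r.

Lemma sharp_fun_is_linear (A : vectType F) (r : tensor A A) :
  linear (sharp_fun r).
Proof.
move=> c p q; rewrite /sharp_fun /tlift scaler_sumr -big_split.
apply: eq_bigr => i _; rewrite /= scaler_sumr -big_split.
apply: eq_bigr => j _; rewrite /= !lfunE /= !lfunE /= scalerDl scalerDr.
by rewrite !scalerA mulrCA mulrA [c * _]mulrC.
Qed.
HB.instance Definition _ (A : vectType F) (r : tensor A A) :=
  GRing.isLinear.Build F (dual A) A *:%R (sharp_fun r) (sharp_fun_is_linear r).

Definition sharp (A : vectType F) (r : tensor A A) : 'Hom(dual A, A) :=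
  linfun (sharp_fun r).

Lemma sharp_sum (A : vectType F) (I : finType) (a b : I -> A) (p : dual A) :
  sharp (\sum_i a i ⊗ b i) p = \sum_i (p (a i) : F) *: b i.
Proof.
rewrite lfunE /= /sharp_fun linear_sum; apply: eq_bigr => i _ /=.
rewrite tlift_tensor //; split=> [v | u] c x y.
  by rewrite linearP /= scalerDl scalerA.
by rewrite scalerDr /= !scalerA mulrC.
Qed.

End Dual.

Section Algebra.
Variables (F : fieldType) (A : vectType F) (mul : {bilinear A -> A -> A}).

Definition lmul (a : A) : 'End(A) := linfun (mul a).
Definition rmul (b : A) : 'End(A) := linfun (mul^~ b).

Lemma lmulE a b : lmul a b = mul a b. Proof. by rewrite lfunE. Qed.
Lemma rmulE a b : rmul b a = mul a b.
Proof. by rewrite /rmul (lfunE (applyr mul b)). Qed.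

Definition derivation (d : 'End(A)) :=
  forall a b, d (mul a b) = mul (d a) b + mul a (d b).

Definition commuting_family (m : nat) (D : 'I_m -> 'End(A)) :=
  forall k l, (D k \o D l = D l \o D k)%VF.

Definition differential_algebra (m : nat) (Phi : 'I_m -> 'End(A)) :=
  [/\ associative mul, forall k, derivation (Phi k) & commuting_family Phi].

(* Each of the three products is quadratic in r; it is defined by lifting the
   formula on pure tensors to each of the two factors r = \sum_i a_i ⊗ b_i and
   r = \sum_j c_j ⊗ d_j.  The lemmas r*_sum give the values for an arbitrary
   decomposition of r. *)
Definition r12r13 (r : tensor A A) : tensor (tensor A A) A :=
  tlift (fun a b => tlift (fun c d => mul a c ⊗ b ⊗ d) r) r.
Definition r13r23 (r : tensor A A) : tensor (tensor A A) A :=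
  tlift (fun a b => tlift (fun c d => a ⊗ c ⊗ mul b d) r) r.
Definition r23r12 (r : tensor A A) : tensor (tensor A A) A :=
  tlift (fun a b => tlift (fun c d => c ⊗ mul a d ⊗ b) r) r.

Section ProductsOfSums.
Variables (W : vectType F) (I : finType) (a b : I -> A).
Local Notation bilin f := (bilinear_for *:%R *:%R f).

Lemma tlift_sum (f : A -> A -> W) : bilin f ->
  tlift f (\sum_i a i ⊗ b i) = \sum_i f (a i) (b i).
Proof.
by move=> fb; rewrite linear_sum; apply: eq_bigr => i _ /=; rewrite tlift_tensor.
Qed.

Lemma tlift2_sum (f : A -> A -> A -> A -> W) :
  (forall x y, bilin (f x y)) -> (forall z t, bilin (fun x y => f x y z t)) ->
  let r := \sum_i a i ⊗ b i in
  tlift (fun x y => tlift (f x y) r) r =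
    \sum_i \sum_j f (a i) (b i) (a j) (b j).
Proof.
move=> f2 f1 /=; rewrite tlift_sum.
  by apply: eq_bigr => i _; rewrite tlift_sum.
by split=> u c x y; rewrite !tlift_sum //= scaler_sumr -big_split;
  apply: eq_bigr => i _ /=; have [l r] := f1 (a i) (b i); rewrite ?(l u) ?(r u).
Qed.

End ProductsOfSums.

Section Products.
Variables (I : finType) (a b : I -> A).
Let r := \sum_i a i ⊗ b i.

Lemma r12r13_sum :
  r12r13 r = \sum_i \sum_j (mul (a i) (a j) ⊗ b i ⊗ b j).
Proof.
have [l2 r2] := @tensor_bilinear F A A.
have [l3 r3] := @tensor_bilinear F (tensor A A) A.
apply: (@tlift2_sum _ _ a b (fun x y z t => mul x z ⊗ y ⊗ t)) => u v.
  split=> w c x y.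
    by rewrite linearPr (l2 v) (l3 w).
  by rewrite (r3 (mul u w ⊗ v)).
split=> w c x y.
  by rewrite linearPl (l2 w) (l3 v).
by rewrite (r2 (mul w u)) (l3 v).
Qed.

Lemma r13r23_sum :
  r13r23 r = \sum_i \sum_j (a i ⊗ a j ⊗ mul (b i) (b j)).
Proof.
have [l2 r2] := @tensor_bilinear F A A.
have [l3 r3] := @tensor_bilinear F (tensor A A) A.
apply: (@tlift2_sum _ _ a b (fun x y z t => x ⊗ z ⊗ mul y t)) => u v.
  split=> w c x y.
    by rewrite (r2 u) (l3 (mul v w)).
  by rewrite linearPr (r3 (u ⊗ w)).
split=> w c x y.
  by rewrite (l2 u) (l3 (mul w v)).
by rewrite linearPl (r3 (w ⊗ u)).
Qed.

Lemma r23r12_sum :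
  r23r12 r = \sum_i \sum_j (a j ⊗ mul (a i) (b j) ⊗ b i).
Proof.
have [l2 r2] := @tensor_bilinear F A A.
have [l3 r3] := @tensor_bilinear F (tensor A A) A.
apply: (@tlift2_sum _ _ a b (fun x y z t => z ⊗ mul x t ⊗ y)) => u v.
  split=> w c x y.
    by rewrite (l2 (mul u w)) (l3 v).
  by rewrite linearPr (r2 w) (l3 v).
split=> w c x y.
  by rewrite linearPl (r2 u) (l3 w).
by rewrite (r3 (u ⊗ mul w v)).
Qed.

End Products.

Definition admissible_AYBE (m : nat) (Phi Psi : 'I_m -> 'End(A))
    (r : tensor A A) :=
  [/\ r12r13 r + r13r23 r - r23r12 r = 0,
      forall k, tmap (Phi k) \1%VF r - tmap \1%VF (Psi k) r = 0
    & forall k, tmap (Psi k) \1%VF r - tmap \1%VF (Phi k) r = 0].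

End Algebra.

(* Main.v *)
Require Import Defs.
From mathcomp Require Import all_boot all_order all_algebra.

Set Implicit Arguments.
Unset Strict Implicit.
Unset Printing Implicit Defensive.

Import GRing.Theory.
Local Open Scope ring_scope.

(** The equivalence is obtained by pairing the first tensor factors with
    functionals, which loses no information on a tensor.

    Write r = \sum_i a_i ⊗ b_i, so that r^#(p) = \sum_i p(a_i) b_i; antisymmetry
    says that \sum_i p(b_i) a_i = - r^#(p).  Pairing the first two factors of
    the Yang-Baxter expression with p and q gives
      - from r12r13:  \sum p(a_i a_j) q(b_i) b_j = - r^#(L^*(r^# q) p), the only
        place where antisymmetry enters this computation;
      - from r13r23:  \sum p(a_i) q(a_j) b_i b_j = r^#(p) r^#(q);
      - from r23r12:  \sum p(a_j) q(a_i b_j) b_i = r^#(R^*(r^# p) q)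
    ([contract_AYBE]).  Hence every such pairing vanishes exactly when the
    operator equation holds; and the functionals p ⊗ q separate the points of
    A ⊗ A ([prod_dual_separates]), so the expression itself then vanishes.

    Pairing the first factor of (ð ⊗ id - id ⊗ ∂)(r) with p gives
    r^#(ð^* p) - ∂ (r^# p), so this condition is ∂ r^# = r^# ð^*
    ([tmap_sharp]).  The other condition, with ∂ and ð exchanged, is its mirror
    image under the swap, hence equivalent to it ([antisymmetric_tmap]). *)

Section Contraction.
Variable F : fieldType.
Implicit Types U V : vectType F.

Definition contract U V (p : dual U) : 'Hom(tensor U V, V) :=
  linfun (tlift (fun (u : U) (v : V) => (p u : F) *: v)).

Lemma contract_tensor U V (p : dual U) (u : U) (v : V) :
  contract V p (u ⊗ v) = (p u : F) *: v.
Proof.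
rewrite lfunE /= tlift_tensor //; split=> [w | w] c x y.
  by rewrite linearP /= scalerDl scalerA.
by rewrite scalerDr /= !scalerA mulrC.
Qed.

Lemma contract_sharp (A : vectType F) (p : dual A) (r : tensor A A) :
  contract A p r = sharp r p.
Proof. by rewrite !lfunE. Qed.

(** Grouping the terms by the basis vector of the second factor leaves a single
    sum of pure tensors whose second components are linearly independent. *)
Lemma tensor_sum U V (t : tensor U V) :
  exists u : 'I_(\dim {:V}) -> U, t = \sum_j u j ⊗ (vbasis {:V})`_j.
Proof.
exists (fun j => \sum_i (t : 'M_(_, _)) i j *: (vbasis {:U})`_i).
apply/matrixP=> k l; rewrite {1}(tensor_decomp t) exchange_big !summxE.
apply: eq_bigr => j _; rewrite summxE !mxE linear_sum mulr_suml.
by apply: eq_bigr => i _; rewrite !mxE linearZ /= mulrA.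
Qed.

(** Relative to a set P of functionals: on A ⊗ A the pairings can be computed
    only for functionals of the form p ⊗ q, which are not all of the dual. *)
Definition separates U (P : dual U -> Prop) :=
  forall u, (forall p, P p -> p u = 0) -> u = 0.

Lemma dual_separates U : separates (fun _ : dual U => True).
Proof.
move=> u u0; rewrite (coord_vbasis (memvf u)) big1 // => i _.
have := u0 (linfun (coord (vbasis {:U}) i : U -> F^o)) I.
by rewrite lfunE /= => ->; rewrite scale0r.
Qed.

(** In \sum_j u_j ⊗ e_j with (e_j) a basis, the pairing with p has coordinates
    p(u_j), so its vanishing for separating p kills every u_j. *)
Lemma contract_separates U V (P : dual U -> Prop) (t : tensor U V) :
  separates P -> (forall p, P p -> contract V p t = 0) -> t = 0.
Proof.
move=> sepP; have [u ->] := tensor_sum t => t0.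
have /freeP indepV := basis_free (vbasisP {:V}).
rewrite big1 // => j _; have -> : u j = 0.
  apply: sepP => p /t0; rewrite linear_sum /=.
  under eq_bigr do rewrite contract_tensor.
  by move/(indepV (fun j => p (u j))).
by apply/matrixP=> k l; rewrite !mxE linear0 mul0r.
Qed.

(** The functional p ⊗ q on U ⊗ V. *)
Definition prod_dual U V (p : dual U) (q : dual V) : dual (tensor U V) :=
  (q \o contract V p)%VF.

Lemma prod_dual_tensor U V (p : dual U) (q : dual V) (u : U) (v : V) :
  prod_dual p q (u ⊗ v) = (p u : F) * (q v : F) :> F.
Proof. by rewrite comp_lfunE contract_tensor linearZ. Qed.

(** Pairing with p ⊗ q is pairing with p and then with q, so the separation
    property is used once for each factor. *)
Lemma prod_dual_separates U V :
  separates (fun f : dual (tensor U V) => exists p q, f = prod_dual p q).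
Proof.
move=> t t0; apply: (contract_separates (@dual_separates U)) => p _.
apply: dual_separates => q _.
by rewrite -comp_lfunE; apply: t0; exists p, q.
Qed.

End Contraction.

Section TensorMapsTheory.
Variable F : fieldType.

Lemma tmap_sum (U V U' V' : vectType F) (f : 'Hom(U, U')) (g : 'Hom(V, V'))
    (I : finType) (u : I -> U) (v : I -> V) :
  tmap f g (\sum_i u i ⊗ v i) = \sum_i f (u i) ⊗ g (v i).
Proof.
rewrite /tmap [LHS]linear_sum; apply: eq_bigr => i _.
exact: tmap_tensor.
Qed.

Lemma tswap_sum (U V : vectType F) (I : finType) (u : I -> U) (v : I -> V) :
  tswap (\sum_i u i ⊗ v i) = \sum_i v i ⊗ u i.
Proof.
rewrite /tswap [LHS]linear_sum; apply: eq_bigr => i _.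
exact: tswap_tensor.
Qed.

Lemma contract_tmap (U V U' V' : vectType F) (f : 'Hom(U, U')) (g : 'Hom(V, V'))
    (p : dual U') (t : tensor U V) :
  contract V' p (tmap f g t) = g (contract V (transpose f p) t).
Proof.
have [u ->] := tensor_sum t; rewrite tmap_sum !linear_sum.
by apply: eq_bigr => j _ /=; rewrite !contract_tensor linearZ transposeE.
Qed.

Lemma tswap_tmap (U V U' V' : vectType F) (f : 'Hom(U, U')) (g : 'Hom(V, V'))
    (t : tensor U V) :
  tswap (tmap f g t) = tmap g f (tswap t).
Proof. by have [u ->] := tensor_sum t; rewrite !(tmap_sum, tswap_sum). Qed.

Variables (A : vectType F) (r : tensor A A).

(** Pairing the left-hand side with p in the first factor gives
    r^#(f^* p) - g (r^# p). *)
Lemma tmap_sharp (f g : 'End(A)) :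
  tmap f \1%VF r - tmap \1%VF g r = 0 <->
  (g \o sharp r = sharp r \o transpose f)%VF.
Proof.
have E (p : dual A) : contract A p (tmap f \1%VF r - tmap \1%VF g r) =
    sharp r (transpose f p) - g (sharp r p).
  rewrite linearB /= !contract_tmap id_lfunE !contract_sharp.
  by congr (_ - g (sharp r _)); apply/lfunP=> u; rewrite transposeE id_lfunE.
split=> [e | e].
  apply/lfunP=> p; rewrite !comp_lfunE; apply/esym/eqP.
  by rewrite -subr_eq0 -E e linear0.
apply: (contract_separates (@dual_separates F A)) => p _.
by rewrite E -!comp_lfunE e subrr.
Qed.

Hypothesis r_anti : antisymmetric_tensor r.

(** The swap turns (f ⊗ id)(r) into (id ⊗ f)(- r), so it carries one equation to
    the other up to sign. *)
Lemma antisymmetric_tmap (f g : 'End(A)) :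
  tmap f \1%VF r - tmap \1%VF g r = 0 -> tmap g \1%VF r - tmap \1%VF f r = 0.
Proof.
move=> /subr0_eq/(congr1 (@tswap F A A)).
have rs : tswap r = - r by rewrite {2}r_anti opprK.
have tN h k : tmap h k (- r) = - tmap h k r by rewrite /tmap linearN.
by rewrite !tswap_tmap rs !tN => /oppr_inj ->; rewrite subrr.
Qed.

Lemma sharp_antisymmetric (I : finType) (a b : I -> A) (p : dual A) :
  r = \sum_i a i ⊗ b i -> \sum_i (p (b i) : F) *: a i = - sharp r p.
Proof.
move=> rE; rewrite r_anti -contract_sharp linearN opprK rE tswap_sum linear_sum.
by apply: eq_bigr => i _ /=; rewrite contract_tensor.
Qed.

Variable mul : {bilinear A -> A -> A}.

(** The three products contribute r^#(L^*(r^# q) p) with sign -, the product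
    of sharps, and r^#(R^*(r^# p) q) with sign -, in this order. *)
Lemma contract_AYBE (p q : dual A) :
  contract A (prod_dual p q) (r12r13 mul r + r13r23 mul r - r23r12 mul r) =
  mul (sharp r p) (sharp r q)
  - sharp r (transpose (rmul mul (sharp r p)) q
             + transpose (lmul mul (sharp r q)) p).
Proof.
have [a rE] := tensor_sum r.
set b := fun j : 'I_(\dim {:A}) => (vbasis {:A})`_j.
rewrite -[X in _ = X]/(\sum_j a j ⊗ b j) in rE.
have sE (s : dual A) : sharp r s = \sum_i (s (a i) : F) *: b i.
  by rewrite rE sharp_sum.
have sN (s : dual A) : sharp r s = - \sum_i (s (b i) : F) *: a i.
  by rewrite (sharp_antisymmetric s rE) opprK.
(* Here the functional q meets the second component of the first copy of r,
   hence the use of sN. *)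
have E12 : contract A (prod_dual p q) (r12r13 mul r) =
    - sharp r (transpose (lmul mul (sharp r q)) p).
  rewrite (sE (transpose _ _)) rE r12r13_sum -rE exchange_big linear_sum -sumrN.
  apply: eq_bigr => j _ /=; rewrite linear_sum transposeE lmulE sN.
  rewrite linearNl linear_sumlz linearN linear_sum scaleNr opprK scaler_suml.
  apply: eq_bigr => i _ /=; rewrite contract_tensor prod_dual_tensor.
  by rewrite linearZl_LR linearZ /= mulrC.
have E13 : contract A (prod_dual p q) (r13r23 mul r) =
    mul (sharp r p) (sharp r q).
  rewrite !sE rE r13r23_sum linear_sumlz linear_sum; apply: eq_bigr => i _ /=.
  rewrite !linear_sum; apply: eq_bigr => j _ /=.
  rewrite contract_tensor prod_dual_tensor linearZl_LR linearZr_LR /=.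
  by rewrite scalerA.
have E23 : contract A (prod_dual p q) (r23r12 mul r) =
    sharp r (transpose (rmul mul (sharp r p)) q).
  rewrite (sE (transpose _ _)) rE r23r12_sum -rE linear_sum.
  apply: eq_bigr => i _ /=; rewrite linear_sum transposeE rmulE sE.
  rewrite !linear_sum scaler_suml; apply: eq_bigr => j _ /=.
  by rewrite contract_tensor prod_dual_tensor linearZr_LR linearZ.
rewrite linearB [in LHS]linearD /= E12 E13 E23 linearD opprD.
by rewrite [- _ + mul _ _]addrC -addrA [- _ + _]addrC.
Qed.

End TensorMapsTheory.

Theorem theorem4p10 (F : fieldType) (charF : [pchar F] =i pred0)
    (A : vectType F) (mul : {bilinear A -> A -> A})
    (m : nat) (Phi : 'I_m -> 'End(A)) (diffA : differential_algebra mul Phi)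
    (r : tensor A A) (r_anti : antisymmetric_tensor r)
    (Psi : 'I_m -> 'End(A)) (Psi_comm : commuting_family Psi) :
  admissible_AYBE mul Phi Psi r <->
    (forall a b : dual A,
       mul (sharp r a) (sharp r b) =
       sharp r (transpose (rmul mul (sharp r a)) b
                + transpose (lmul mul (sharp r b)) a))
    /\ (forall k : 'I_m,
          (Phi k \o sharp r = sharp r \o transpose (Psi k))%VF).
Proof.
have AYBE_sharp := contract_AYBE r_anti mul.
split=> [[ybe _ Psi_Phi] | [sharpM sharp_Phi]].
  split=> [p q | k]; last exact/tmap_sharp.
  by apply/eqP; rewrite -subr_eq0 -AYBE_sharp ybe linear0.
have Psi_Phi k : tmap (Psi k) \1%VF r - tmap \1%VF (Phi k) r = 0.
  exact/tmap_sharp.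
split=> // [|k]; last exact: antisymmetric_tmap.
apply: (contract_separates (@prod_dual_separates F A A)) => _ [p [q ->]].
by rewrite AYBE_sharp sharpM subrr.
Qed.
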